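(* Let $A_2$ be a real $2\times 2$ matrix of rank two with all entries non-zero. Let $p_0,p_1$ be two points of $\mathbb{R}^2$ satisfying $(p_0,p_1)\in(\mathbb{R}^2)^2-\Sigma$, where $\Sigma\subset(\mathbb{R}^2)^2$ is the hypersurface defined by $(x_0-x_1)(y_0-y_1)=0$ in the standard coordinates $((x_0,y_0),(x_1,y_1))$. Then, for any positive real numbers $a,b$ with $a\ne b$, there exists a point $q=(q_0,q_1)\in\mathbb{R}^2$ such that $(q,(0,0))\in(\mathbb{R}^2)^2-\Sigma$ and $G_{(p_0,p_1,A_2)}$ is $\mathcal{A}$-equivalent to the mapping $F_q:\mathbb{R}^2\to\mathbb{R}^2$ defined by $$F_q(x,y)=\left((x-q_0)^2+(y-q_1)^2,\ ax^2+by^2\right).$$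
   Context: For points $p_0=(p_{00},p_{01})$, $p_1=(p_{10},p_{11})$ of $\mathbb{R}^2$ and a real $2\times2$ matrix $A=(a_{ij})_{0\le i,j\le1}$ with non-zero entries, the generalized distance-squared mapping $G_{(p_0,p_1,A)}:\mathbb{R}^2\to\mathbb{R}^2$ is $$G_{(p_0,p_1,A)}(x,y)=\left(a_{00}(x-p_{00})^2+a_{01}(y-p_{01})^2,\ a_{10}(x-p_{10})^2+a_{11}(y-p_{11})^2\right).$$ Two mappings $f_1,f_2:\mathbb{R}^2\to\mathbb{R}^2$ are $\mathcal{A}$-equivalent if there exist $C^\infty$ diffeomorphisms $h,H:\mathbb{R}^2\to\mathbb{R}^2$ such that $f_1=H\circ f_2\circ h$. *)

(* Defs.v *)
From mathcomp Require Import all_boot all_order all_algebra.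
From mathcomp Require Import all_classical all_reals all_analysis.

Set Implicit Arguments.
Unset Strict Implicit.
Unset Printing Implicit Defensive.

Import Order.TTheory GRing.Theory Num.Theory.
Import numFieldNormedType.Exports.

Local Open Scope classical_set_scope.
Local Open Scope ring_scope.

Notation plane R := (R * R)%type.

Definition gen_dist_sq (R : realType) (p0 p1 : plane R) (A : 'M[R]_2)
    (z : plane R) : plane R :=
  (A 0 0 * (z.1 - p0.1) ^+ 2 + A 0 1 * (z.2 - p0.2) ^+ 2,
   A 1 0 * (z.1 - p1.1) ^+ 2 + A 1 1 * (z.2 - p1.2) ^+ 2).

(* C^(k+1): both first-order partial derivatives exist everywhere and are C^k.
   The directional derivative along a basis vector is taken in the product
   space, i.e. componentwise in the values of f. *)
Fixpoint class_C (R : realType) (k : nat) (f : plane R -> plane R) : Prop :=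
  match k with
  | 0 => continuous f
  | k'.+1 => forall e : plane R, e = (1, 0) \/ e = (0, 1) ->
      (forall z, derivable f z e) /\ class_C k' (fun z => 'D_e f z)
  end.

(* Membership in every C^k is required, k = 0 included, so all iterated
   partial derivatives of f exist and are continuous. *)
Definition smooth (R : realType) (f : plane R -> plane R) : Prop :=
  forall k, class_C k f.

Definition diffeomorphism (R : realType) (h : plane R -> plane R) : Prop :=
  smooth h /\ exists g, [/\ smooth g, cancel h g & cancel g h].

Definition A_equivalent (R : realType) (f1 f2 : plane R -> plane R) : Prop :=
  exists h H : plane R -> plane R,
    [/\ diffeomorphism h, diffeomorphism H & f1 = H \o f2 \o h].

Definition Sigma (R : realType) : set (plane R * plane R) :=
  [set p | (p.1.1 - p.2.1) * (p.1.2 - p.2.2) = 0].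
Arguments Sigma : clear implicits.

(* Main.v *)
Require Import Defs.
From mathcomp Require Import all_boot all_order all_algebra.
From mathcomp Require Import all_classical all_reals all_analysis.
From mathcomp Require Import ring.

Import Order.TTheory GRing.Theory Num.Theory.
Import numFieldNormedType.Exports.

Local Open Scope classical_set_scope.
Local Open Scope ring_scope.

(** Since [A2] is invertible, composing [gen_dist_sq p0 p1 A2] on the left with
    an affine map and on the right with a translation brings it to the form
    [(x ^ 2 + c y, y ^ 2 + d x)], where [c] and [d] are nonzero multiples of
    [p0.2 - p1.2] and [p0.1 - p1.1].  The map [F_q] has the same normal form,
    with [c] and [d] nonzero multiples of [q.2] and [q.1], so [q] can be chosen
    to make the two normal forms coincide. *)

Definition affine_map {R : realType} (m00 m01 m10 m11 k0 k1 : R) (z : plane R) :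
    plane R :=
  (m00 * z.1 + m01 * z.2 + k0, m10 * z.1 + m11 * z.2 + k1).

(** The difference quotient equals [c] for every [t != 0], so it is eventually constant in the
    punctured neighbourhoods of 0. *)
Lemma derivable_of_constant_slope {R : realType} (f : plane R -> plane R)
    (e c z : plane R) :
  (forall t, f (t *: e + z) = t *: c + f z) ->
  derivable f z e /\ 'D_e f z = c.
Proof.
move=> fE.
have cvg_slope : (fun t : R => t^-1 *: (f (t *: e + z) - f z)) @ 0^' --> c.
  apply: cvg_near_cst; near=> t.
  have t_neq0 : t != 0 by near: t; exact: nbhs_dnbhs_neq.
  by rewrite fE addrK scalerA mulVf // scale1r.
split; first by apply/cvg_ex; exists c.
exact: cvg_lim cvg_slope.
Unshelve. all: by end_near. Qed.

Lemma class_C_cst {R : realType} (k : nat) (c : plane R) :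
  class_C k (fun _ : plane R => c).
Proof.
elim: k c => [|k IHk] c; first exact: cst_continuous.
move=> e _.
have D0 z := @derivable_of_constant_slope R (fun=> c) e 0 z
  (fun t => esym (etrans (congr1 (+%R^~ c) (scaler0 _ t)) (add0r c))).
split=> [z|]; first by case: (D0 z).
rewrite (_ : (fun z => 'D_e _ z) = fun=> 0); first exact: IHk.
by apply/funext => z; case: (D0 z).
Qed.

(** One differentiation leaves a constant, the linear part applied to [e], so every higher order
    reduces to the constant case. *)
Lemma smooth_affine_map {R : realType} (m00 m01 m10 m11 k0 k1 : R) :
  smooth (affine_map m00 m01 m10 m11 k0 k1).
Proof.
case=> [z|k e _].
  have c1 : (fun w : plane R => w.1) @ z --> z.1 by exact: cvg_fst.
  have c2 : (fun w : plane R => w.2) @ z --> z.2 by exact: cvg_snd.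
  have affine_cvg m m' k : m * w.1 + m' * w.2 + k @[w --> z] -->
      m * z.1 + m' * z.2 + k.
    apply: cvgD; last exact: cvg_cst.
    by apply: cvgD; apply: cvgM => //; exact: cvg_cst.
  exact: cvg_pair (affine_cvg m00 m01 k0) (affine_cvg m10 m11 k1).
have DE z : derivable (affine_map m00 m01 m10 m11 k0 k1) z e /\
    'D_e (affine_map m00 m01 m10 m11 k0 k1) z =
      affine_map m00 m01 m10 m11 0 0 e.
  apply: derivable_of_constant_slope => t.
  by congr pair; rewrite /= /GRing.scale /=; ring.
split=> [z|]; first by case: (DE z).
rewrite (_ : (fun z => 'D_e _ z) = fun=> affine_map m00 m01 m10 m11 0 0 e).
  exact: class_C_cst.
by apply/funext => z; case: (DE z).
Qed.

Lemma diffeomorphism_affine_map {R : realType} (m00 m01 m10 m11 k0 k1 : R) :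
  m00 * m11 - m01 * m10 != 0 ->
  diffeomorphism (affine_map m00 m01 m10 m11 k0 k1).
Proof.
move=> D_neq0; split; first exact: smooth_affine_map.
pose D := m00 * m11 - m01 * m10.
(* Cramer's rule gives the inverse. *)
exists (affine_map (m11 / D) (- m01 / D) (- m10 / D) (m00 / D)
  ((m01 * k1 - m11 * k0) / D) ((m10 * k0 - m00 * k1) / D)).
split; first exact: smooth_affine_map.
- by move=> [x y]; congr pair; rewrite /= /D; field.
- by move=> [x y]; congr pair; rewrite /= /D; field.
Qed.

Lemma det_mx22 {F : comNzRingType} (A : 'M[F]_2) :
  \det A = A 0 0 * A 1 1 - A 0 1 * A 1 0.
Proof.
rewrite (expand_det_row _ 0) !big_ord_recl big_ord0 /cofactor !det_mx11 !mxE /=.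
have -> : lift 0 0 = 1 :> 'I_2 by apply/val_inj.
have -> : lift 1 0 = 0 :> 'I_2 by apply/val_inj.
by rewrite /= expr0 expr1 mul1r mulN1r addr0 mulrN.
Qed.

Theorem proposition3 (R : realType) (A2 : 'M[R]_2)
  (rankA2 : \rank A2 = 2%N) (A2_neq0 : forall i j, A2 i j != 0)
  (p0 p1 : plane R) (p_notin : (~` Sigma R) (p0, p1))
  (a b : R) (a_gt0 : 0 < a) (b_gt0 : 0 < b) (a_neq_b : a != b) :
  exists q : plane R,
    (~` Sigma R) (q, (0, 0)) /\
    A_equivalent (gen_dist_sq p0 p1 A2)
      (fun z : plane R =>
         ((z.1 - q.1) ^+ 2 + (z.2 - q.2) ^+ 2, a * z.1 ^+ 2 + b * z.2 ^+ 2)).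
Proof.
have : \det A2 != 0.
  by rewrite -unitfE -unitmxE -row_full_unit /row_full rankA2.
rewrite det_mx22 /gen_dist_sq.
move: (A2_neq0 0 0) (A2_neq0 0 1) (A2_neq0 1 0) (A2_neq0 1 1).
move: (A2 0 0) (A2 0 1) (A2 1 0) (A2 1 1) => a00 a01 a10 a11.
move=> a00_neq0 a01_neq0 a10_neq0 a11_neq0 det_neq0.
have a_neq0 : a != 0 by rewrite gt_eqF.
have b_neq0 : b != 0 by rewrite gt_eqF.
have ba_neq0 : b - a != 0 by rewrite subr_eq0 eq_sym.
case: p0 p1 p_notin => [p00 p01] [p10 p11] /= /eqP.
rewrite mulf_eq0 negb_or => /andP[px_neq py_neq].
pose det := a00 * a11 - a01 * a10.
(* Matching the coefficients of [x] gives the linear system [a00 * s - m00 * q0 = - a00 * p00],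
   [a10 * s - m10 * q0 = - a10 * p10], solved by [q0] and [s]. The coefficients of [y] give [q1] and
   [t] likewise. *)
pose q0 := (b - a) * a00 * a10 * (p00 - p10) / (a * det).
pose q1 := (b - a) * a01 * a11 * (p01 - p11) / (b * det).
pose s := b * q0 / (b - a) - (a11 * a00 * p00 - a01 * a10 * p10) / det.
pose t := - (a * q1 / (b - a)) - (a00 * a11 * p11 - a10 * a01 * p01) / det.
(* [m] is [A2] times the inverse of the matrix [[1, 1], [a, b]] of [F_q]. *)
pose m00 := (a00 * b - a01 * a) / (b - a).
pose m01 := (a01 - a00) / (b - a).
pose m10 := (a10 * b - a11 * a) / (b - a).
pose m11 := (a11 - a10) / (b - a).
(* [(c0, c1)] is the value of [F_q] at [(s, t)], the image of the origin under the source
   translation; subtracting its image under [m] below matches the constant terms. *)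
pose c0 := (s - q0) ^+ 2 + (t - q1) ^+ 2.
pose c1 := a * s ^+ 2 + b * t ^+ 2.
exists (q0, q1); split.
  (* Each factor of [q0] and [q1] is nonzero; the factors [p00 - p10] and [p01 - p11] are so because
     [(p0, p1)] avoids [Sigma]. *)
  apply/eqP; rewrite /= !subr0 /q0 /q1.
  by rewrite !(mulf_neq0, invr_neq0).
exists (affine_map 1 0 0 1 s t), (affine_map m00 m01 m10 m11
  (a00 * p00 ^+ 2 + a01 * p01 ^+ 2 - m00 * c0 - m01 * c1)
  (a10 * p10 ^+ 2 + a11 * p11 ^+ 2 - m10 * c0 - m11 * c1)).
split.
- by apply: diffeomorphism_affine_map; rewrite mulr1 mulr0 subr0 oner_neq0.
- apply: diffeomorphism_affine_map.
  (* Determinants are multiplicative, and [[[1, 1], [a, b]]] has determinant [b - a]. *)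
  rewrite (_ : _ - _ = det / (b - a)); last first.
    by rewrite /m00 /m01 /m10 /m11 /det; field.
  by rewrite mulf_neq0 // invr_neq0.
- apply/funext => -[x y]; congr pair;
    rewrite /= /c0 /c1 /m00 /m01 /m10 /m11 /s /t /q0 /q1 /det;
    by field; apply/and4P.
Qed.
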